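(* Let $X$ be an infinite set of cardinality $\kappa$. If $X$ has regular cardinality, then the maximal submonoids of $\mathcal O^{(1)}$ which contain all permutations of $X$ are exactly the monoid $\mathcal A=\{f\in\mathcal O^{(1)}: f^{-1}[\{y\}]\text{ is small for almost all }y\in X\}$ and the monoids $\mathcal G_\lambda$ and $\mathcal M_\lambda$ for $\lambda=1$ and $\aleph_0\leq\lambda\leq\kappa$, $\lambda$ a cardinal, where $$\mathcal G_\lambda=\{f\in\mathcal O^{(1)}:\text{ if }A\subseteq X\text{ has cardinality }\lambda\text{ then }|X\setminus f[X\setminus A]|\geq\lambda\},$$ $$\mathcal M_\lambda=\{f\in\mathcal O^{(1)}: f\text{ is }\lambda\text{-surjective or not }\lambda\text{-injective}\}.$$ If $X$ has singular cardinality, then the same is true with the monoid $\mathcal A$ replaced by $$\mathcal A'=\{f\in\mathcal O^{(1)}:\exists\lambda<\kappa\ (|f^{-1}[\{x\}]|\leq\lambda\text{ for almost all }x\in X)\}.$$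
   Context: $\mathcal O^{(1)}$ is the monoid (under composition) of all functions $X\to X$; a maximal submonoid is one maximal among the proper submonoids with respect to inclusion. A subset of $X$ is small if its cardinality is less than $\kappa=|X|$; a property holds for almost all $y\in X$ if the set of $y$ for which it fails is small. For a cardinal $\lambda\leq\kappa$, $f\in\mathcal O^{(1)}$ is $\lambda$-surjective if $|X\setminus f[X]|<\lambda$, and $\lambda$-injective if $|\{x\in X:\exists y\neq x\ (f(x)=f(y))\}|<\lambda$. In the definition of $\mathcal A'$, $\lambda$ ranges over cardinals. *)

(* Defs.v *)
From mathcomp Require Import all_boot boolp classical_sets functions cardinality.

Set Implicit Arguments.
Unset Strict Implicit.
Unset Printing Implicit Defensive.

Local Open Scope classical_set_scope.
Local Open Scope card_scope.

(* Cardinals are represented by sets, compared with #<= and #=. Every cardinal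
   lambda <= |X| is the cardinality of some L : set X, so a quantification over
   such lambda is a quantification over L : set X in which only the cardinality
   of L matters. *)

Definition card_lt T U (A : set T) (B : set U) : Prop :=
  A #<= B /\ ~ (B #<= A).

Definition small (X : Type) (A : set X) : Prop := card_lt A [set: X].

Definition almost_all (X : Type) (P : X -> Prop) : Prop :=
  small [set y | ~ P y].

(* For infinite X, |X| is regular if X is not the union of fewer than |X| sets,
   each of cardinality less than |X|; it is singular otherwise. *)
Definition regular_card (X : Type) : Prop :=
  forall F : set (set X), card_lt F [set: X] ->
    (forall A, F A -> small A) -> \bigcup_(A in F) A <> [set: X].

Definition singular_card (X : Type) : Prop := ~ regular_card X.

Definition submonoid (X : Type) (M : set (X -> X)) : Prop :=
  M id /\ (forall f g, M f -> M g -> M (f \o g)).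

Definition maximal_submonoid (X : Type) (M : set (X -> X)) : Prop :=
  [/\ submonoid M, M <> setT &
      forall N : set (X -> X), submonoid N -> N <> setT -> M `<=` N -> N = M].

Definition all_permutations (X : Type) : set (X -> X) := [set f | bijective f].
Arguments all_permutations X : clear implicits.

Definition card_surjective (X : Type) (L : set X) (f : X -> X) : Prop :=
  card_lt (~` range f) L.

Definition card_injective (X : Type) (L : set X) (f : X -> X) : Prop :=
  card_lt [set x | exists y, y <> x /\ f x = f y] L.

Definition monA (X : Type) : set (X -> X) :=
  [set f | almost_all (fun y => small (f @^-1` [set y]))].
Arguments monA X : clear implicits.

Definition monA' (X : Type) : set (X -> X) :=
  [set f | exists L : set X,
    small L /\ almost_all (fun x => f @^-1` [set x] #<= L)].
Arguments monA' X : clear implicits.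

Definition monG (X : Type) (L : set X) : set (X -> X) :=
  [set f | forall A : set X, A #= L -> L #<= ~` (f @` (~` A))].

Definition monM (X : Type) (L : set X) : set (X -> X) :=
  [set f | card_surjective L f \/ ~ card_injective L f].

(* |L| = 1 or |L| >= aleph_0; |L| <= |X| is automatic. *)
Definition one_or_infinite (X : Type) (L : set X) : Prop :=
  L #= [set: unit] \/ [set: nat] #<= L.

(* Main.v *)
Require Import Defs.
From mathcomp Require Import all_boot boolp classical_sets functions cardinality.
From mathcomp Require wochoice.

(** Let [K] be the cardinality of [X], and call a set of functions listed if
    it is [monG L] or [monM L] with [|L|] equal to 1 or infinite, or if it is
    [monA X] (regular case) or [monA' X] (singular case). Every listed set is a
    proper submonoid that contains the permutations. Two facts then identify
    the listed monoids with the maximal ones: no listed monoid is included in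
    another one, and a submonoid [N] that contains the permutations and is
    included in no listed monoid contains all functions.

    The second fact is a construction. Functions of [N] outside the various
    [monM L] combine, by induction on [|L|], into an injection of [N] whose
    range misses [K] points ([injection_of_corange_ge]); up to permutations all
    such injections are the same, so [N] contains them all. Dually, functions
    outside the various [monG L] combine into a function of [N] that still maps
    onto [X] after the removal of [K] points ([surjection_off_ge]). Such a
    function spreads fibres ([fibres_everywhere]): as soon as some function of
    [N] has [K] fibres of size [K], some [s] in [N] has all its fibres of size
    [K]. Then every [f] factors as [s \o J], where [J x] is chosen in the fibre
    of [s] over [f x] so as to make [J] an injection missing [K] points
    ([all_from_large_fibres]).

    It remains to find [K] fibres of size [K]. A function outside [monA X] has
    them by definition. A function [h] outside [monA' X] only has, for each
    small [L], [K] fibres larger than [L]; when [X] is covered by a small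
    family [F] of small sets, distinct representatives give [K] disjoint
    columns, each containing for every [B] in [F] a point whose fibre under [h]
    is at least as large as [B], and a function of [N] with all fibres as large
    as [F] collapses each column to one point ([singular_large_fibres]).
    Regularity of [K] is what makes [monA X] closed under
    composition.

    The first fact needs four functions that do not depend on [L] (an injection
    missing [K] points, a two-to-one surjection, a surjection with all fibres of
    size [K], and its composite with the injection) and, to tell [monG L] from
    [monG L'] and [monM L] from [monM L'], functions adapted to two different
    cardinals.

    The cardinal arithmetic comes from Zorn's lemma: comparability and well
    foundedness of cardinals ([card_minimal]), and [L `*` L #<= L] for infinite
    [L] ([infinite_square]). *)

Set Implicit Arguments.
Unset Strict Implicit.
Unset Printing Implicit Defensive.

Local Open Scope classical_set_scope.
Local Open Scope card_scope.

(** * Comparing cardinalities *)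

Lemma inj_on_card_le T U (A : set T) (B : set U) (f : T -> U) :
  (forall x, A x -> B (f x)) ->
  (forall x y, A x -> A y -> f x = f y -> x = y) -> A #<= B.
Proof.
move=> fAB finj.
have /card_eqPle[_ AfA] : f @` A #= A.
  by apply: inj_card_eq => x y /set_mem Ax /set_mem Ay; exact: finj.
by apply: card_le_trans AfA (subset_card_le _) => _ [x /fAB ? <-].
Qed.

Lemma card_le_surj T U (A : set T) (B : set U) (f : T -> U) :
  B `<=` f @` A -> B #<= A.
Proof. by move=> /subset_card_le/card_le_trans; apply; exact: card_image_le. Qed.

(** A point of the codomain turns an injection between subtypes into a total
    function; for this reason the carrier is a pointed type below. *)
Lemma card_leE T (U : pointedType) (A : set T) (B : set U) : A #<= B ->
  exists f : T -> U, (forall x, A x -> B (f x)) /\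
    (forall x y, A x -> A y -> f x = f y -> x = y).
Proof.
move=> /pcard_leP/injfunPex[f fAB finj]; exists f; split => // x y Ax Ay.
by apply: finj; exact: mem_set.
Qed.

Lemma card_eqE T (U : pointedType) (A : set T) (B : set U) : A #= B ->
  exists f : T -> U, [/\ forall x, A x -> B (f x),
    forall x y, A x -> A y -> f x = f y -> x = y &
    forall y, B y -> exists2 x, A x & f x = y].
Proof.
move=> /card_set_bijP[f [fAB finj fsurj]]; exists f; split => // x y Ax Ay.
by apply: finj; exact: mem_set.
Qed.

Lemma card_le_nonempty T U (A : set T) (B : set U) x :
  A x -> A #<= B -> B !=set0.
Proof.
move=> Ax AB; apply/set0P/eqP => B0; move: AB.
by rewrite B0 => /card_le0P A0; rewrite A0 in Ax.
Qed.

Lemma subset_of_card T (U : pointedType) (L : set T) (A : set U) : L #<= A ->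
  exists2 B, B `<=` A & B #= L.
Proof.
move=> /card_leE[f [fA finj]]; exists (f @` L); first by move=> _ [x /fA ? <-].
by apply: inj_card_eq => x y /set_mem Lx /set_mem Ly; exact: finj.
Qed.

(** Take a maximal set of choice functions on the family that differ pairwise
    at every index. If every member of the family had a point reached by none of
    them, these points would form one more choice function; so one member is
    exhausted, and evaluation at any other index injects it there. *)
Lemma card_minimal (X : Type) (P : set (set X)) : P !=set0 ->
  exists2 A, P A & forall B, P B -> A #<= B.
Proof.
move=> [A0 PA0]; pose I := {A : set X | P A}.
pose good (S : set (I -> X)) :=
  (forall s, S s -> forall i, sval i (s i)) /\
  (forall s t, S s -> S t -> forall i, s i = t i -> s = t).
have [F FS totF|S [[Sin Sinj] Smax]] := @Zorn_bigcup (I -> X) good.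
  split=> [s [S FS_ Ss] i|s t [S1 FS1 Ss] [S2 FS2 St] i].
    by have [+ _] := FS _ FS_; apply.
  have [S12|S21] := totF _ _ FS1 FS2.
    by have [_] := FS _ FS2; apply => //; exact: S12.
  by have [_] := FS _ FS1; apply => //; exact: S21.
have [i iS] : exists i : I, forall x, sval i x -> exists2 s, S s & s i = x.
  apply: contrapT => /forallNP noi.
  have /choice[s sP] : forall i : I, exists x, sval i x /\ forall s, S s -> s i <> x.
    move=> i; have /existsNP[x /not_implyP[ix nx]] := noi i.
    by exists x; split => // s Ss six; apply: nx; exists s.
  apply: (Smax (S `|` [set s])).
    split; first by move=> t St; left.
    move=> /(_ s (or_intror erefl)) Ss; exact: (sP (exist _ _ PA0)).2 Ss erefl.
  split=> [t [/Sin//|-> i]|t u]; first exact: (sP i).1.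
  move=> [St|->] [Su|->]//; first exact: Sinj.
    by move=> i tsi; case: ((sP i).2 _ St).
  by move=> i tsi; case: ((sP i).2 _ Su).
exists (sval i) => [|B PB]; first by case: i {iS}.
have /choice[c cP] : forall x, exists s, sval i x -> S s /\ s i = x.
  move=> x; have [/iS[s Ss six]|nx] := pselect (sval i x); first by exists s.
  by exists (fun=> x).
apply: (@inj_on_card_le _ _ _ _ (fun x => c x (exist _ B PB))) => [x /cP[Sc _]|x y].
  exact: Sin Sc (exist _ B PB).
move=> /cP[Sx cx] /cP[Sy cy] cxy.
by rewrite (Sinj _ _ Sx Sy (exist _ B PB) cxy) cy in cx.
Qed.

(** Sets in different types become members of one family in the sum type. *)
Lemma card_le_total T U (A : set T) (B : set U) : A #<= B \/ B #<= A.
Proof.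
pose A' : set (T + U) := inl @` A; pose B' : set (T + U) := inr @` B.
have AA' : A' #= A by apply: inj_card_eq => x y _ _ [].
have BB' : B' #= B by apply: inj_card_eq => x y _ _ [].
have [|C [->|->] CP] := @card_minimal _ [set A'; B']; first by exists A'; left.
  left; rewrite -(card_le_eql AA') -(card_le_eqr BB'); apply: CP; by right.
right; rewrite -(card_le_eqr AA') -(card_le_eql BB'); apply: CP; by left.
Qed.

Lemma card_ltNge T U (A : set T) (B : set U) : ~ (B #<= A) -> card_lt A B.
Proof. by move=> nBA; split => //; have [//|/nBA] := card_le_total A B. Qed.

Lemma card_Nlt T U (A : set T) (B : set U) : ~ card_lt A B -> B #<= A.
Proof. by move=> nAB; apply: contrapT => /card_ltNge. Qed.

Lemma card_le_lt_trans T U V (A : set T) (B : set U) (C : set V) :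
  A #<= B -> card_lt B C -> card_lt A C.
Proof.
move=> AB [BC nCB]; split; first exact: card_le_trans BC.
by move=> /card_le_trans/(_ AB).
Qed.

Lemma card_lt_le_trans T U V (A : set T) (B : set U) (C : set V) :
  card_lt A B -> B #<= C -> card_lt A C.
Proof.
move=> [AB nBA] BC; split; first exact: card_le_trans BC.
by move=> /(card_le_trans BC).
Qed.

Lemma card_lt_eql T U V (A : set T) (B : set U) (C : set V) :
  A #= B -> card_lt A C = card_lt B C.
Proof. by move=> AB; rewrite /card_lt (card_le_eql AB) (card_le_eqr AB). Qed.

Lemma card_lt_eqr T U V (A : set T) (B : set U) (C : set V) :
  B #= C -> card_lt A B = card_lt A C.
Proof. by move=> AB; rewrite /card_lt (card_le_eql AB) (card_le_eqr AB). Qed.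

Lemma card_lt_ind (X : Type) (P : set X -> Prop) :
  (forall A, (forall B : set X, card_lt B A -> P B) -> P A) -> forall A, P A.
Proof.
move=> ind; apply: contrapT => /existsNP[A0 nPA0].
have [|A nPA Amin] := @card_minimal X [set A | ~ P A]; first by exists A0.
by apply: nPA; apply: ind => B [_ nAB]; apply: contrapT => /Amin/nAB.
Qed.

Lemma finite_card_lt T U (A : set T) (B : set U) :
  finite_set A -> infinite_set B -> card_lt A B.
Proof. by move=> fA iB; apply: card_ltNge => /card_le_finite/(_ fA)/iB. Qed.

Lemma card_le_succ T (A : set T) a n : `I_n #<= A -> ~ A a ->
  `I_n.+1 #<= a |` A.
Proof.
elim/Ppointed: T => T in A a *; first by case: (no a).
move=> /card_leE[e [eA einj]] Aa.
apply: (@inj_on_card_le _ _ _ _ (fun k => if (k < n)%N then e k else a)).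
  by move=> k _; case: ifPn => [/eA|_]; [right|left].
move=> k l /=; rewrite !ltnS => kn ln.
case: ltnP => [kn'|nk]; case: ltnP => [ln'|nl].
- exact: einj.
- by move=> ka; case: Aa; rewrite -ka; exact: eA.
- by move=> la; case: Aa; rewrite la; exact: eA.
- by move=> _; apply/eqP; rewrite eqn_leq (leq_trans kn nl) (leq_trans ln nk).
Qed.

(** * Squares and unions of infinite sets *)

Lemma card_leX T T' U U' (A : set T) (B : set U) (A' : set T') (B' : set U') :
  A #<= A' -> B #<= B' -> A `*` B #<= A' `*` B'.
Proof.
elim/Ppointed: T' => T' in A' *.
  rewrite [A']empty_eq0 => /card_le0P -> _.
  by rewrite set0X card_ge0.
elim/Ppointed: U' => U' in B' *.
  rewrite [B']empty_eq0 => _ /card_le0P ->.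
  by rewrite setX0 card_ge0.
move=> /card_leE[f [fA finj]] /card_leE[g [gB ginj]].
apply: (@inj_on_card_le _ _ _ _ (fun x => (f x.1, g x.2))).
  by move=> [x y] /= [/fA ? /gB ?].
by move=> [x y] [x' y'] /= [Ax By] [Ax' By'] [/finj -> // /ginj ->].
Qed.

Lemma infinite_two T (A : set T) : infinite_set A ->
  exists a b, [/\ A a, A b & a <> b].
Proof.
move=> iA; have [a Aa] := infinite_setN0 iA.
have [b [Ab ba]] := infinite_setN0 (infinite_setD iA (finite_set1 a)).
by exists a, b; split => // ab; apply: ba; rewrite /= ab.
Qed.

(** Elements of [A] and of [B] are coded by pairs with two different first
    components. The bound on the square is a hypothesis because the proof of
    [infinite_square] relies on this lemma. *)
Lemma card_leU_square T V (A : set T) (B : set T) (L : set V) :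
  infinite_set L -> L `*` L #<= L -> A #<= L -> B #<= L -> A `|` B #<= L.
Proof.
move=> iL LL; have [a [b [La Lb ab]]] := infinite_two iL.
elim/Ppointed: V => V in L iL LL a b La Lb ab *.
  by case: iL; rewrite empty_eq0; exact: finite_set0.
move=> /card_leE[f [fA finj]] /card_leE[g [gB ginj]].
apply: card_le_trans LL.
pose h x := if pselect (A x) then (a, f x) else (b, g x).
apply: (@inj_on_card_le _ _ _ _ h) => [x|x y]; rewrite /h.
  by case: pselect => [Ax _|nAx []//]; split => //=; [exact: fA|exact: gB].
case: pselect => [Ax _|nAx []// Bx]; case: pselect => [Ay _|nAy []// By] [].
- exact: finj.
- by move=> /ab.
- by move=> /esym/ab.
- exact: ginj.
Qed.

(** Zorn's lemma gives a maximal infinite [A] in [D] with an injection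
    [g : A `*` A -> A]. If [A] is smaller than [D], then [D `\` A] contains a copy
    of [A], into which the pairs not yet coded can be sent, against maximality.
    So [D #<= A], and the bound passes from [A] to [D]. *)
Lemma infinite_square T (D : set T) : infinite_set D -> D `*` D #<= D.
Proof.
elim/Ppointed: T => T in D *; first by rewrite empty_eq0 setX0.
move=> iD.
pose good (p : set T * (T * T -> T)) := [/\ p.1 `<=` D, infinite_set p.1,
  forall x, (p.1 `*` p.1) x -> p.1 (p.2 x) &
  forall x y, (p.1 `*` p.1) x -> (p.1 `*` p.1) y -> p.2 x = p.2 y -> x = y].
pose W := {p | good p}.
pose R (p q : W) := `[< (sval p).1 `<=` (sval q).1 /\
  forall x, ((sval p).1 `*` (sval p).1) x -> (sval q).2 x = (sval p).2 x >].
have t0 : W.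
  have /infiniteP/subset_of_card/cid2[A AD Anat] := iD.
  have /card_eqPle[Anat1 Anat2] := Anat.
  have /card_leE/cid[g [gA ginj]] : A `*` A #<= A.
    apply: card_le_trans Anat2; have := card_leX Anat1 Anat1.
    move=> /card_le_trans; apply; rewrite setXTT.
    exact: countableP.
  exists (A, g); split => //=.
  by rewrite (eq_finite_set Anat); exact: infinite_nat.
have Rrefl p : R p p by apply/asboolP; split.
have Rtrans : forall r s t, R r s -> R s t -> R r t.
  move=> r s t /asboolP[rs rs2] /asboolP[st st2]; apply/asboolP; split.
    exact: subset_trans st.
  by move=> x rx; rewrite st2 ?rs2//; case: rx => ? ?; split; exact: rs.
have [C totC|[[A g] [/= AD iA gA ginj]] Amax] := ZL_preorder t0 Rrefl Rtrans.
  have [[c0 Cc0]|C0] := pselect (C !=set0); last first.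
    by exists t0 => s Cs; case: C0; exists s.
  pose U := \bigcup_(c in C) (sval c).1.
  have Uc x : (U `*` U) x -> exists2 c, C c & ((sval c).1 `*` (sval c).1) x.
    move=> [[c Cc cx] [d Cd dx]]; have [/asboolP[cd _]|/asboolP[dc _]] := totC _ _ Cc Cd.
      by exists d => //; split => //; exact: cd.
    by exists c => //; split => //; exact: dc.
  have /choice[g gP] : forall x, exists y, forall c, C c ->
      ((sval c).1 `*` (sval c).1) x -> y = (sval c).2 x.
    move=> x; have [/Uc[c Cc cx]|nU] := pselect ((U `*` U) x); last first.
      exists point => c Cc [cx1 cx2]; case: nU; split; by exists c.
    exists ((sval c).2 x) => d Cd dx.
    have [/asboolP[_ cd]|/asboolP[_ dc]] := totC _ _ Cc Cd.
      by rewrite cd.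
    by rewrite dc.
  have gU : good (U, g).
    split => /=.
    - by move=> x [c Cc cx]; have [cD _ _ _] := svalP c; exact: cD.
    - have [_ ic _ _] := svalP c0; apply: sub_infinite_set ic => x c0x.
      by exists c0.
    - move=> x /Uc[c Cc cx]; exists c => //; rewrite (gP _ _ Cc cx).
      by have [_ _ + _] := svalP c; apply.
    - move=> x y /Uc[c Cc cx] /Uc[d Cd dy]; rewrite (gP _ _ Cc cx) (gP _ _ Cd dy).
      have [/asboolP[cd cd2]|/asboolP[dc dc2]] := totC _ _ Cc Cd.
        rewrite -cd2//; have [_ _ _] := svalP d; apply => //.
        by case: cx => *; split; exact: cd.
      rewrite -dc2//; have [_ _ _] := svalP c; apply => //.
      by case: dy => *; split; exact: dc.
  exists (exist _ (U, g) gU) => c Cc; apply/asboolP; split => /=.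
    by move=> x cx; exists c.
  by move=> x cx; apply: gP.
have AA : A `*` A #<= A by exact: (inj_on_card_le gA).
have [DA|nDA] := pselect (D #<= A).
  apply: card_le_trans (card_leX DA DA) _; apply: card_le_trans AA _.
  exact: subset_card_le.
exfalso.
have [ADA|DAA] := card_le_total A (D `\` A); last first.
  apply: nDA; rewrite -(setDUK AD); apply: card_leU_square => //.
have [ph [phDA phinj]] := card_leE ADA.
have /choice[ps psP] : forall x, exists y, forall a, A a -> ph a = x -> y = a.
  move=> x; have [[a Aa <-]|nx] := pselect ((ph @` A) x).
    by exists a => b Ab /(phinj _ _ Ab Aa) ->.
  by exists point => a Aa ax; case: nx; exists a.
have psK a : A a -> ps (ph a) = a by move=> Aa; exact: psP.
have [a0 [a1 [Aa0 Aa1 a01]]] := infinite_two iA.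
(* An element of [E] is determined by its tag and its base point, both in
   [A]; so [e], which packs two tags and two base points with [g], is injective
   on [E `*` E]. *)
pose E := A `|` ph @` A.
pose base x := if pselect (A x) then x else ps x.
pose tag x := if pselect (A x) then a0 else a1.
have base_in x : E x -> A (base x).
  by rewrite /base; case: pselect => //= nAx [//|[a Aa <-]]; rewrite psK.
have tag_in x : A (tag x) by rewrite /tag; case: pselect.
have bt_inj x y : E x -> E y -> base x = base y -> tag x = tag y -> x = y.
  rewrite /base /tag; case: pselect => [Ax|nAx] Ex; case: pselect => [Ay|nAy] Ey /=.
  - by [].
  - by move=> _ /a01.
  - by move=> _ /esym/a01.
  - case: Ex => [//|[a Aa <-]]; case: Ey => [//|[b Ab <-]].
    by rewrite !psK// => ->.
pose e x := g (g (tag x.1, tag x.2), g (base x.1, base x.2)).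
have g_in u v : A u -> A v -> A (g (u, v)) by move=> Au Av; apply: (gA).
have g_inj u v u' v' : A u -> A v -> A u' -> A v' ->
    g (u, v) = g (u', v') -> u = u' /\ v = v'.
  move=> Au Av Au' Av' guv; have uv : (u, v) = (u', v') by apply: (ginj).
  by case: uv.
have e_in x : (E `*` E) x -> A (e x).
  by move=> [Ex1 Ex2]; do 2 apply: (g_in) => //; exact: base_in.
have e_inj x y : (E `*` E) x -> (E `*` E) y -> e x = e y -> x = y.
  case: x y => [x1 x2] [y1 y2] [/= Ex1 Ex2] [/= Ey1 Ey2] exy.
  have [||||t b] := g_inj _ _ _ _ _ _ _ _ exy; try by apply: (g_in) => //; exact: base_in.
  have [||||t1 t2] := g_inj _ _ _ _ _ _ _ _ t; try exact: tag_in.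
  have [||||b1 b2] := g_inj _ _ _ _ _ _ _ _ b; try exact: base_in.
  by rewrite (bt_inj x1 y1)// (bt_inj x2 y2).
pose g' x := if pselect ((A `*` A) x) then g x else ph (e x).
have gE : good (E, g').
  split => /=.
  - by move=> x [/AD//|[a /phDA[+ _] <-]].
  - by apply: sub_infinite_set (iA) => x; left.
  - move=> x Ex; rewrite /g'; case: pselect => [Ax|nAx] /=; first by left; apply: (gA).
    by right; exists (e x) => //; exact: e_in.
  - move=> x y Ex Ey; rewrite /g'.
    case: pselect => [Ax|nAx]; case: pselect => [Ay|nAy] /= ee.
    + by apply: (ginj).
    + by have [_ []] := phDA _ (e_in _ Ey); rewrite -ee; apply: (gA).
    + by have [_ []] := phDA _ (e_in _ Ex); rewrite ee; apply: (gA).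
    + by apply: e_inj => //; apply: phinj ee; exact: e_in.
have /asboolP[/= EA _] : R (exist _ (E, g') gE) (exist _ (A, g) (And4 AD iA gA ginj)).
  apply: Amax; apply/asboolP; split => /=; first by move=> x; left.
  by move=> x Ax; rewrite /g'; case: pselect.
have [_ []] := phDA _ Aa0.
by apply: EA; right; exists a0.
Qed.

Lemma card_leU T V (A : set T) (B : set T) (L : set V) :
  infinite_set L -> A #<= L -> B #<= L -> A `|` B #<= L.
Proof. by move=> iL; apply: card_leU_square => //; exact: infinite_square. Qed.

Lemma card_ltU T V (A : set T) (B : set T) (L : set V) :
  infinite_set L -> card_lt A L -> card_lt B L -> card_lt (A `|` B) L.
Proof.
move=> iL; wlog AB : A B / A #<= B => [wl AL BL|AL BL].
  have [AB|BA] := card_le_total A B; first exact: wl.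
  by rewrite setUC; exact: wl.
have [fB|iB] := pselect (finite_set B).
  apply: finite_card_lt => //; rewrite finite_setU; split => //.
  exact: card_le_finite AB fB.
by apply: card_le_lt_trans BL; exact: card_leU.
Qed.

(** Otherwise [A] would be covered by two sets smaller than [L]. *)
Lemma card_leD T (A B : set T) V (L : set V) : infinite_set L ->
  L #<= A -> card_lt B L -> L #<= A `\` B.
Proof.
move=> iL LA BL; apply: contrapT => /card_ltNge AB.
have [_] := card_ltU iL AB BL; apply; apply: card_le_trans LA _.
by apply: subset_card_le => x Ax; have [Bx|nBx] := pselect (B x); [right|left].
Qed.

(** A point is coded by the index of one member that contains it and by its
    code in that member. *)
Lemma card_le_bigcup T U V W (I : set T) (F : T -> set U) (L : set V) (M : set W) :
  I #<= L -> (forall i, I i -> F i #<= M) -> \bigcup_(i in I) F i #<= L `*` M.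
Proof.
elim/Ppointed: W => W in M *.
  rewrite empty_eq0 => _ FM; rewrite (_ : \bigcup_(i in I) F i = set0) ?card_ge0//.
  by rewrite bigcup0// => i /FM/card_le0P.
move=> IL FM; apply: card_le_trans (card_leX IL (card_lexx M)).
have [[i0 Ii0]|I0] := pselect (I !=set0); last first.
  rewrite (_ : \bigcup_(i in I) F i = set0) ?card_ge0//.
  by rewrite bigcup0// => i Ii; case: I0; exists i.
have /choice[c cP] : forall x, exists i, (\bigcup_(i in I) F i) x -> I i /\ F i x.
  move=> x; have [[i Ii Fix]|nx] := pselect ((\bigcup_(i in I) F i) x).
    by exists i.
  by exists i0.
have /choice[e eP] : forall i, exists e : U -> W, I i ->
   (forall x, F i x -> M (e x)) /\
    (forall x y, F i x -> F i y -> e x = e y -> x = y).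
  move=> i; have [/FM/card_leE[e ?]|?] := pselect (I i); first by exists e.
  by exists (fun=> point).
apply: (@inj_on_card_le _ _ _ _ (fun x => (c x, e (c x) x))) => [x /cP[Ic Fc]|x y].
  by split => //=; exact: (eP _ Ic).1.
move=> /cP[Ix Fx] /cP[Iy Fy] [cxy]; rewrite -cxy in Fy *.
exact: (eP _ Ix).2.
Qed.

(** * Small well-orders and distinct representatives *)

(** Cut a well-order of [X] at the least point whose initial segment is as
    large as [X], if there is one, and pull the order of that segment back to
    [X]: all shorter segments are small. *)
Lemma small_well_order (X : pointedType) : exists lt : X -> X -> Prop,
  [/\ well_founded lt, (forall x y, x <> y -> lt x y \/ lt y x) &
      forall x, small [set y | lt y x]].
Proof.
have [R Rwo] := wochoice.well_ordering_principle X.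
have Rmin (P : set X) : P !=set0 -> exists2 m, P m & forall x, P x -> R m x.
  move=> [x Px]; have [|m [[mP mmin] _]] := Rwo (fun x => `[< P x >]).
    by exists x; exact/asboolP.
  exists m; first by move: mP => /asboolP.
  by move=> y Py; apply: mmin; exact/asboolP.
have Ranti x y : R x y -> R y x -> x = y.
  have [|m [_ mu]] := Rwo (fun z => (z == x) || (z == y)).
    by exists x; rewrite unfold_in eqxx.
  have Rxx z : R z z.
    by have [|t -> tz] := Rmin [set z]; [exists z|exact: tz].
  move=> Rxy Ryx; transitivity m; [symmetry|]; apply: mu; split.
  - by rewrite unfold_in eqxx.
  - by move=> z; rewrite unfold_in => /orP[/eqP ->|/eqP ->].
  - by rewrite unfold_in eqxx orbT.
  - by move=> z; rewrite unfold_in => /orP[/eqP ->|/eqP ->].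
pose lt0 x y := R x y /\ x <> y.
have lt0_total x y : x <> y -> lt0 x y \/ lt0 y x.
  move=> xy; have [|m [->|->] mP] := Rmin [set x; y]; first by exists x; left.
    by left; split => //; apply: mP; right.
  by right; split; [apply: mP; left|move/esym].
have lt0_wf : well_founded lt0.
  move=> x; apply: contrapT => nx.
  have [|m nm mP] := Rmin [set x | ~ Acc lt0 x]; first by exists x.
  apply: nm; constructor => y [Rym ym]; apply: contrapT => /mP Rmy.
  by apply: ym; exact: Ranti.
have [[b Kb]|nob] := pselect (exists x, [set: X] #<= [set y | lt0 y x]); last first.
  exists lt0; split => // x; apply: card_ltNge => Kx.
  by apply: nob; exists x.
have [|m Km mP] := Rmin [set x | [set: X] #<= [set y | lt0 y x]].
  by exists b.
have [e [em einj]] := card_leE Km.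
exists (fun x y => lt0 (e x) (e y)); split.
- move=> x; move: {-2}(e x) (lt0_wf (e x)) (erefl (e x)) => u au.
  elim: au x => {}u _ IH x eux; constructor => y yx.
  by apply: (IH (e y)) => //; rewrite -eux.
- move=> x y xy; apply: lt0_total => /einj exy; apply: xy; exact: exy.
- move=> x; apply: card_ltNge => Kx; have [Rxm xm] := em x I.
  apply: xm; apply: Ranti => //; apply: mP => /=; apply: card_le_trans Kx _.
  by apply: (@inj_on_card_le _ _ _ _ e) => // y z _ _ /einj ->.
Qed.

(** Recursion along a small well-order: at each stage only a small set of
    values is already used, which cannot exhaust [Y x]. *)
Lemma distinct_representatives (X : pointedType) (Y : X -> set X) :
  (forall x, [set: X] #<= Y x) ->
  exists2 c : X -> X, injective c & forall x, Y x (c x).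
Proof.
move=> KY; have [lt [wf tot sm]] := small_well_order X.
pose F x (rec : forall y, lt y x -> X) : X :=
  xget point [set y | Y x y /\ forall z (h : lt z x), rec z h <> y].
pose c := Fix wf (fun=> X) F.
have cE x : c x = xget point [set y | Y x y /\ forall z, lt z x -> c z <> y].
  rewrite /c Fix_eq// => y f g fg; congr F.
  by apply: functional_extensionality_dep => z; apply: funext => p.
have cP x : Y x (c x) /\ forall z, lt z x -> c z <> c x.
  rewrite [c x]cE; apply: (@xgetPex _ point
    [set y | Y x y /\ forall z, lt z x -> c z <> y]).
  apply: contrapT => /forallNP nex; have [_] := sm x; apply.
  apply: card_le_trans (KY x) (card_le_surj (f := c) _) => y Yy.
  apply: contrapT => ny; apply: (nex y); split => // z zx czy.
  by apply: ny; exists z.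
exists c => [x y cxy|x]; last exact: (cP x).1.
apply: contrapT => /tot[xy|yx]; first exact: (cP y).2 xy cxy.
exact: (cP x).2 yx (esym cxy).
Qed.

(** * Permutations and injections of an infinite type *)

Lemma inj_surj_bijective T (U : Type) (f : T -> U) : injective f ->
  (forall y, exists x, f x = y) -> bijective f.
Proof.
move=> finj /choice[g fg]; exists g => // x; apply: finj; exact: fg.
Qed.

Lemma bijective_surj T U (f : T -> U) y : bijective f -> exists x, f x = y.
Proof. by move=> [g _ fg]; exists (g y); rewrite fg. Qed.

(** The partial map sending [u t] to [v t] is completed by a bijection between
    the complements of its domain and of its range. *)
Lemma permutation_extension T (X : pointedType) (D : set T) (u v : T -> X) :
  {in D &, injective u} -> {in D &, injective v} ->
  ~` (u @` D) #= ~` (v @` D) ->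
  exists2 p : X -> X, bijective p & forall t, D t -> p (u t) = v t.
Proof.
move=> uinj vinj /card_eqE[w [wv winj wsurj]].
have /choice[p pP] : forall x, exists y,
    (forall t, D t -> u t = x -> y = v t) /\ (~ (u @` D) x -> y = w x).
  move=> x; have [[t Dt utx]|nx] := pselect ((u @` D) x).
    exists (v t); split => [s Ds usx|[]]; last by exists t.
    by congr v; apply: uinj; rewrite ?inE// usx.
  by exists (w x); split => // t Dt utx; case: nx; exists t.
have pu t : D t -> p (u t) = v t by move=> Dt; apply: (pP _).1.
have pw x : ~ (u @` D) x -> p x = w x by apply: (pP _).2.
exists p => //; apply: inj_surj_bijective => [x y|y].
  have [[s Ds <-]|nx] := pselect ((u @` D) x);
    have [[t Dt <-]|ny] := pselect ((u @` D) y).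
  - by rewrite !pu// => vst; congr u; apply: vinj; rewrite ?inE.
  - by rewrite pu// pw// => e; case: (wv _ ny); rewrite -e; exists s.
  - by rewrite pu// pw// => e; case: (wv _ nx); rewrite e; exists t.
  - by rewrite !pw//; exact: winj.
have [[t Dt <-]|ny] := pselect ((v @` D) y); first by exists (u t); exact: pu.
by have [x nx <-] := wsurj _ ny; exists x; exact: pw.
Qed.

Section InfiniteType.
Variable X : pointedType.
Hypothesis Xinf : infinite_set [set: X].
Local Notation K := [set: X].

Lemma large_eq (A : set X) : K #<= A -> A #= K.
Proof. by move=> KA; apply/card_eqPle; split => //; exact: card_leT. Qed.

Lemma large_complement (A : set X) : small A -> K #<= ~` A.
Proof. by move=> sA; rewrite -setTD; exact: card_leD. Qed.

Lemma small_subset (A B : set X) : A `<=` B -> small B -> small A.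
Proof. by move=> AB; apply: card_le_lt_trans; exact: subset_card_le. Qed.

Lemma small_or (A B : set X) : small A -> small B -> small (A `|` B).
Proof. exact: card_ltU. Qed.

Lemma pairing : exists q : X * X -> X, bijective q.
Proof.
have XX : [set: X * X] #= K.
  apply/card_eqPle; split; first by rewrite -setXTT; exact: infinite_square.
  by apply: (@inj_on_card_le _ _ _ _ (fun x => (x, x))) => // x y _ _ [].
have [q [_ qinj qsurj]] := card_eqE XX; exists q.
apply: inj_surj_bijective => [x y|y]; first exact: qinj.
by have [x _ <-] := qsurj y I; exists x.
Qed.

(** In the square of [X], a line is disjoint from a parallel one. *)
Lemma large_corange_injection : exists2 j : X -> X, injective j & K #<= ~` range j.
Proof.
have [q [q' qK q'K]] := pairing; have [a [b [_ _ ab]]] := infinite_two Xinf.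
exists (fun x => q (a, x)); first by move=> x y /(can_inj qK)[].
apply: (@inj_on_card_le _ _ _ _ (fun x => q (b, x))).
  by move=> x _ [y _ /(can_inj qK)[] /ab].
by move=> x y _ _ /(can_inj qK)[].
Qed.

(** Every cardinality up to that of [X] is realised with a large complement,
    which leaves room for the functions built below. *)
Lemma exists_copy (L : set X) : exists2 C : set X, C #= L & ~` C #= K.
Proof.
have [j jinj Kj] := large_corange_injection.
exists (j @` L); first by apply: inj_card_eq => x y _ _ /jinj.
apply: large_eq; apply: card_le_trans Kj (subset_card_le _).
by apply: subsetC => _ [x _ <-]; exists x.
Qed.

(** Complements of small sets are all equinumerous, so nothing but the size of
    [D] and [E] matters. *)
Lemma permutation_of_small_sets (D E : set X) : small D -> D #= E ->
  exists2 p : X -> X, bijective p & forall x, E (p x) <-> D x.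
Proof.
move=> sD DE; have [v [vE vinj vsurj]] := card_eqE DE.
have vD : v @` D = E.
  by apply/seteqP; split => [_ [x /vE ? <-]//|y /vsurj[x ? <-]]; exists x.
have [|||p pbij pD] := @permutation_extension X X D id v.
- by move=> x y _ _.
- by move=> x y /set_mem Dx /set_mem Dy; exact: vinj.
- rewrite image_id vD.
  rewrite (card_eql (large_eq (large_complement sD))) card_eq_sym.
  by apply: large_eq; apply: large_complement; rewrite /small -(card_lt_eql _ DE).
exists p => // x; split => [|Dx]; last by rewrite pD//; exact: vE.
by move=> /vsurj[y Dy]; rewrite -pD// => /(bij_inj pbij) <-.
Qed.

End InfiniteType.

(** * Generating the monoid of all functions *)

Section Generation.
Variable X : pointedType.
Hypothesis Xinf : infinite_set [set: X].
Local Notation K := [set: X].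
Variable N : set (X -> X).
Hypothesis Nmonoid : submonoid N.
Hypothesis Nperm : all_permutations X `<=` N.

Let N_comp f g : N f -> N g -> N (f \o g). Proof. exact: Nmonoid.2. Qed.

Lemma singleton_one (x : X) : one_or_infinite [set x].
Proof. by left; rewrite (_ : setT = [set tt]) ?eq_card1//; apply/seteqP; split=> -[]. Qed.

(** Induction on [|L|]. For infinite [L], a function [f] of [N] outside [monM L]
    misses [|L|] points and fails to be injective only on a set [S] smaller than
    [L]. By induction some injection [g] in [N] misses [|S|] points; a permutation
    [p] takes these missed points to [S], so that [f] is injective on the range
    of [p \o g]. For finite [L], iterate an injection that misses one point. *)
Lemma injection_of_corange_ge (L : set X) :
  (forall M : set X, one_or_infinite M -> ~ (N `<=` monM M)) ->
  exists g, [/\ N g, injective g & L #<= ~` range g].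
Proof.
move=> avoid.
have bad (M : set X) : one_or_infinite M -> exists f,
    [/\ N f, M #<= ~` range f & card_injective M f].
  move=> /avoid/existsNP[f /not_implyP[Nf nf]]; exists f; split => //.
    by apply: card_Nlt => fs; apply: nf; left.
  by apply: contrapT => fi; apply: nf; right.
elim/card_lt_ind: L => L IH.
have [[n Ln]|Linf] := pselect (finite_set L).
  suff [g [? ? gn]] : exists g, [/\ N g, injective g & `I_n #<= ~` range g].
    by exists g; split => //; rewrite (card_le_eql Ln).
  elim: n {L IH Ln} => [|n [g [Ng ginj ng]]].
    by exists id; split => //; [exact: Nmonoid.1|rewrite II0 card_ge0].
  (* Failing to be injective at fewer than one point means being injective. *)
  have [f [Nf f1 Sf]] := bad _ (singleton_one point).
  have [a fa] := card_le_nonempty (erefl : [set point] point) f1.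
  have finj : injective f.
    move=> x y fxy; apply: contrapT => xy; have [_] := Sf; apply.
    apply: (@inj_on_card_le _ _ _ _ (fun=> x)) => [u _|u v -> ->//].
    by exists y; split => // /esym.
  exists (g \o f); split; [exact: N_comp|exact: inj_comp|].
  apply: card_le_trans (card_le_succ (a := g a) ng _) (subset_card_le _).
    by apply; exists a.
  move=> z [->|gx] [y _] /=; first by move=> /ginj fy; apply: fa; exists y.
  by move=> gfy; apply: gx; exists (f y).
have [|f [Nf fL Sf]] := bad L; first by right; exact/infiniteP.
pose S := [set x | exists y, y <> x /\ f x = f y].
have [g [Ng ginj Sg]] := IH S Sf.
have sS : small S by apply: card_lt_le_trans Sf _; exact: card_leT.
have [C Cg CS] := subset_of_card Sg.
have sC : small C by rewrite /small (card_lt_eql _ CS).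
have [p pbij pC] := permutation_of_small_sets Xinf sC CS.
exists (f \o (p \o g)); split.
- by apply: N_comp => //; apply: N_comp => //; exact: Nperm.
- move=> x y /= fxy; apply: ginj; apply: (bij_inj pbij).
  apply: contrapT => pxy.
  have : S (p (g x)) by exists (p (g y)); split => // /esym.
  by move=> /pC/Cg; apply; exists x.
- apply: card_le_trans fL (subset_card_le _).
  by apply: subsetC => _ [x _ <-]; exists (p (g x)).
Qed.

(** The dual induction. For infinite [L], a function [f] of [N] outside [monG L]
    maps the complement of a set [A] of size [|L|] onto all of [X] but a set [D]
    smaller than [L]. By induction some [g] in [N] can do without a copy of [D],
    and a permutation between [f] and [g] moves [D] onto that copy. *)
Lemma surjection_off_ge (L : set X) :
  (forall M : set X, one_or_infinite M -> ~ (N `<=` monG M)) ->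
  exists f (A : set X), [/\ N f, L #<= A & f @` (~` A) = setT].
Proof.
move=> avoid.
have bad (M : set X) : one_or_infinite M -> exists f (A : set X),
    [/\ N f, A #= M & card_lt (~` (f @` (~` A))) M].
  move=> /avoid/existsNP[f /not_implyP[Nf /existsNP[A /not_implyP[AM nf]]]].
  by exists f, A; split => //; exact: card_ltNge.
elim/card_lt_ind: L => L IH.
have [[n Ln]|Linf] := pselect (finite_set L).
  suff [f [A [? nA ?]]] : exists f (A : set X),
      [/\ N f, `I_n #<= A & f @` (~` A) = setT].
    by exists f, A; split => //; rewrite (card_le_eql Ln).
  elim: n {L IH Ln} => [|n [g [B [Ng nB gB]]]].
    exists id, set0; split; rewrite ?setC0 ?image_id//; first exact: Nmonoid.1.
    by rewrite II0 card_ge0.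
  have [f [A [Nf A1 fA]]] := bad _ (singleton_one point).
  have {}fA : f @` (~` A) = setT.
    apply: contrapT => fAT; have [y ny] : exists y, ~ (f @` (~` A)) y.
      by apply/existsNP => fT; apply: fAT; rewrite -subTset => y _.
    have [_] := fA; apply.
    by apply: (@inj_on_card_le _ _ _ _ (fun=> y)) => // u v -> ->.
  have [a Aa] : A !=set0.
    have /card_eqPle[_] := A1; exact: card_le_nonempty (erefl : [set point] point).
  have Aeq x : A x -> x = a.
    have /card_eqPle[/card_leE[h [hp hinj]] _] := A1.
    by move=> Ax; apply: hinj => //; rewrite (hp _ Ax) (hp _ Aa).
  have [b Bb gb] : (g @` (~` B)) a by rewrite gB.
  exists (f \o g), (b |` B); split; [exact: N_comp|exact: card_le_succ|].
  rewrite -subTset => y _; have [x nx <-] : (f @` (~` A)) y by rewrite fA.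
  have [z Bz gz] : (g @` (~` B)) x by rewrite gB.
  exists z; last by rewrite /= gz.
  by move=> [zb|//]; apply: nx; rewrite -gz zb gb.
have [|f [A [Nf AL fA]]] := bad L; first by right; exact/infiniteP.
set D := ~` (f @` (~` A)) in fA.
have [g [B [Ng DB gB]]] := IH D fA.
have sD : small D by apply: card_lt_le_trans fA _; exact: card_leT.
have [E EB ED] := subset_of_card DB.
have DE : D #= E by rewrite card_eq_sym.
have [p pbij pE] := permutation_of_small_sets Xinf sD DE.
exists (g \o (p \o f)), A; split.
- by apply: N_comp => //; apply: N_comp => //; exact: Nperm.
- by have /card_eqPle[] := AL.
- rewrite -subTset => y _; have [x Bx <-] : (g @` (~` B)) y by rewrite gB.
  have [z zx] := bijective_surj x pbij.
  have [w Aw fw] : (f @` (~` A)) z.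
    by apply: contrapT => Dz; apply: Bx; apply: EB; rewrite -zx; exact/pE.
  by exists w => //=; rewrite fw zx.
Qed.

(** Two injections missing [K] points differ by a permutation on the left. *)
Lemma large_corange_injections_in g j :
  N g -> injective g -> K #<= ~` range g ->
  injective j -> K #<= ~` range j -> N j.
Proof.
move=> Ng ginj Kg jinj Kj.
have [|||p pbij pg] := @permutation_extension X X setT g j.
- by move=> x y _ _ /ginj.
- by move=> x y _ _ /jinj.
- by rewrite (card_eql (large_eq Kg)) card_eq_sym; exact: large_eq.
have -> : j = p \o g by apply: funext => x /=; rewrite pg.
by apply: N_comp => //; exact: Nperm.
Qed.

(** A right inverse [t] of [f] with values off [A] is an injection missing [K]
    points, so a permutation [p] carries [K] points of [Y] onto the range of [t];
    in [f \o (p \o h)] the fibre over [z] then contains a fibre of [h] over a point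
    of [Y]. *)
Lemma fibres_everywhere f (A : set X) h (Y : set X) :
  N f -> K #<= A -> f @` (~` A) = setT -> N h -> K #<= Y ->
  exists2 s, N s & forall z, exists2 y, Y y & h @^-1` [set y] `<=` s @^-1` [set z].
Proof.
move=> Nf KA fA Nh KY.
have /choice[t tP] : forall z, exists x, ~ A x /\ f x = z.
  by move=> z; have [x Ax fx] : (f @` (~` A)) z by [rewrite fA]; exists x.
have tinj : injective t by move=> x y txy; rewrite -(tP x).2 -(tP y).2 txy.
have [j jinj Kj] := large_corange_injection Xinf.
have [e [eY einj]] := card_leE KY.
have einj' : injective e by move=> x y; exact: einj.
have [|||p pbij pe] := @permutation_extension X X setT (e \o j) t.
- by move=> x y _ _ /einj'/jinj.
- by move=> x y _ _ /tinj.
- have Kej : K #<= ~` range (e \o j).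
    apply: card_le_trans Kj _; apply: (@inj_on_card_le _ _ _ _ e).
      by move=> x nx [y _ /einj' yx]; apply: nx; exists y.
    by move=> x y _ _ /einj'.
  rewrite (card_eql (large_eq Kej)) card_eq_sym; apply: large_eq.
  apply: card_le_trans KA (subset_card_le _) => x Ax [z _ zx].
  by apply: (tP z).1; rewrite zx.
exists (f \o (p \o h)).
  by apply: N_comp => //; apply: N_comp => //; exact: Nperm.
move=> z; exists (e (j z)); first exact: eY.
by move=> x /= ->; rewrite pe//; exact: (tP z).2.
Qed.

(** Every [f] is [s \o J] for an injection [J] with [J x] in the fibre of [s]
    over [f x]. Taking [J x] to be the code of [j x] in that fibre, for an
    injection [j] missing [K] points, makes [J] miss [K] points as well. *)
Lemma all_from_large_fibres s :
  (forall j, injective j -> K #<= ~` range j -> N j) ->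
  N s -> (forall z, K #<= s @^-1` [set z]) -> N = setT.
Proof.
move=> Ninj Ns Ks; rewrite -subTset => f _.
have /choice[e eP] : forall z, exists e : X -> X,
    injective e /\ forall x, s (e x) = z.
  move=> z; have [e [ez einj]] := card_leE (Ks z).
  by exists e; split => x; [move=> y; exact: einj|exact: ez].
have [j jinj Kj] := large_corange_injection Xinf.
pose J x := e (f x) (j x).
have sJ x : s (J x) = f x by exact: (eP _).2.
have -> : f = s \o J by apply: funext => x /=; rewrite sJ.
apply: N_comp => //; apply: Ninj.
  move=> x y Jxy; have fxy : f x = f y by rewrite -!sJ Jxy.
  by apply: jinj; apply: (eP (f y)).1; move: Jxy; rewrite /J fxy.
apply: card_le_trans Kj _; apply: (@inj_on_card_le _ _ _ _ (e point)).
  move=> x nx [y _ yx]; apply: nx; exists y => //.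
  have fy : f y = point by rewrite -sJ yx; exact: (eP _).2.
  by apply: (eP point).1; rewrite -yx /J fy.
by move=> x y _ _ /(eP point).1.
Qed.

End Generation.

(** * The listed sets of functions are monoids *)

Section Monoids.
Variable X : pointedType.
Hypothesis Xinf : infinite_set [set: X].
Local Notation K := [set: X].

Lemma small_finite (A : set X) : finite_set A -> small A.
Proof. by move=> fA; exact: finite_card_lt. Qed.

(** Regularity speaks of covers of [X]: a union as large as [X] would be pulled
    back to such a cover along an injection of [X] into it. *)
Lemma regular_bigcup T (D : set T) (G : T -> set X) : regular_card X ->
  card_lt D K -> (forall i, D i -> small (G i)) -> small (\bigcup_(i in D) G i).
Proof.
move=> reg DK sG; apply: contrapT => /card_Nlt/card_leE[e [eU einj]].
pose H i := e @^-1` (G i).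
apply: (reg (H @` D)).
- by apply: card_le_lt_trans DK; exact: card_image_le.
- move=> _ [i /sG sGi <-]; apply: card_le_lt_trans sGi.
  by apply: (@inj_on_card_le _ _ _ _ e) => // x y _ _; exact: einj.
- rewrite -subTset => x _; have [i Di Gi] := eU x I.
  by exists (H i) => //; exists i.
Qed.

Lemma comp_fibre (f g : X -> X) y :
  (f \o g) @^-1` [set y] = \bigcup_(x in f @^-1` [set y]) g @^-1` [set x].
Proof.
apply/seteqP; split=> [x fgx|x [z fz gz]]; first by exists (g x).
by rewrite /= gz.
Qed.

(** The fibre of [f \o g] over [y] is the union of the fibres of [g] over that
    of [f]. It can be large only if [y] is exceptional for [f] or is the image
    under [f] of a point exceptional for [g]. *)
Lemma submonoid_monA : regular_card X -> submonoid (monA X).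
Proof.
move=> reg; split=> [|f g Af Ag].
  apply: (@small_subset _ _ set0); last exact: small_finite.
  move=> y /= []; apply: small_finite.
  by apply: sub_finite_set (finite_set1 y) => x.
apply: (@small_subset _ _ ([set y | ~ small (f @^-1` [set y])] `|`
  f @` [set x | ~ small (g @^-1` [set x])])).
  move=> y /= nsm; apply: contrapT => /not_orP[/contrapT fy ngy].
  apply: nsm; rewrite comp_fibre; apply: regular_bigcup => // x fx.
  by apply: contrapT => gx; apply: ngy; exists x.
apply: small_or => //.
by apply: card_le_lt_trans Ag; exact: card_image_le.
Qed.

(** If one factor is infinite, the larger factor absorbs the product. *)
Lemma small_product (L M : set X) : small L -> small M ->
  exists2 P : set X, small P & L `*` M #<= P.
Proof.
move=> sL sM.
have LMK : card_lt (L `*` M) K.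
  wlog LM : L M sL sM / L #<= M => [wl|].
    have [|ML] := card_le_total L M; first exact: wl.
    have MLK := wl M L sM sL ML; apply: card_le_lt_trans MLK.
    apply: (@inj_on_card_le _ _ _ _ (fun x => (x.2, x.1))).
      by move=> x [].
    by move=> [x y] [x' y'] _ _ [-> ->].
  have [fM|iM] := pselect (finite_set M).
    apply: finite_card_lt => //; apply: finite_setX => //.
    exact: card_le_finite LM fM.
  apply: card_le_lt_trans sM.
  exact: card_le_trans (card_leX LM (card_lexx M)) (infinite_square iM).
have [P _ PLM] := subset_of_card LMK.1.
exists P; first by rewrite /small (card_lt_eql _ PLM).
by have /card_eqPle[] := PLM.
Qed.

(** As for [monA], with the product of the two uniform bounds in place of
    regularity. *)
Lemma submonoid_monA' : submonoid (monA' X).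
Proof.
split=> [|f g [L [sL Af]] [M [sM Ag]]].
  exists [set point]; split; first by apply: small_finite.
  apply: (@small_subset _ _ set0); last exact: small_finite.
  move=> y /= []; apply: (@inj_on_card_le _ _ _ _ (fun=> point)) => //.
  by move=> x x' /= -> ->.
have [P sP LMP] := small_product sL sM.
exists P; split => //.
apply: (@small_subset _ _ ([set y | ~ (f @^-1` [set y] #<= L)] `|`
  f @` [set x | ~ (g @^-1` [set x] #<= M)])).
  move=> y /= nsm; apply: contrapT => /not_orP[/contrapT fy ngy].
  apply: nsm; rewrite comp_fibre; apply: card_le_trans LMP.
  apply: card_le_bigcup => // x fx.
  by apply: contrapT => gx; apply: ngy; exists x.
apply: small_or => //.
by apply: card_le_lt_trans Ag; exact: card_image_le.
Qed.

(** Among the points that [g] misses off [A] there is a set of the size of [A],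
    to which the property of [f] applies. *)
Lemma submonoid_monG (L : set X) : submonoid (monG L).
Proof.
split=> [A AL|f g Gf Gg A AL].
  by rewrite image_id setCK; have /card_eqPle[] := AL.
have [B Bg BL] := subset_of_card (Gg _ AL).
apply: card_le_trans (Gf _ BL) (subset_card_le _).
apply: subsetC => _ [x Ax <-]; exists (g x) => // Bx.
by apply: (Bg _ Bx); exists x.
Qed.

(** Among nonzero cardinals, 1 and the infinite ones are exactly those closed
    under sums of two smaller cardinals; [monM] is a monoid for this reason. *)
Lemma one_or_infinite_ltU (L A B : set X) : one_or_infinite L ->
  card_lt A L -> card_lt B L -> card_lt (A `|` B) L.
Proof.
move=> [L1|/infiniteP iL]; last exact: card_ltU.
have E C : card_lt C L -> C = set0.
  move=> [_ nLC]; apply/seteqP; split=> // x Cx; apply: nLC.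
  rewrite (card_le_eql L1).
  by apply: (@inj_on_card_le _ _ _ _ (fun=> x)) => // -[] [].
by move=> AL /E ->; rewrite setU0.
Qed.

(** The delicate case is [g] surjective up to fewer than [|L|] points and [f]
    not injective up to fewer than [|L|] points. A point where [f] is not
    injective is then missed by [g], or has all its partners missed by [g], or
    lifts along [g] to a point where [f \o g] is not injective. The first two
    kinds are fewer than [|L|], so the third kind must reach [|L|]. *)
Lemma submonoid_monM (L : set X) : one_or_infinite L -> submonoid (monM L).
Proof.
move=> oL; split=> [|f g Mf Mg].
  left; rewrite /card_surjective (_ : ~` range id = set0); last first.
    by apply/seteqP; split => // x; apply; exists x.
  apply: card_ltNge => /card_le0P L0; case: oL; rewrite L0.
    by rewrite card_eq_sym card_eq0 => /eqP; rewrite -subset0 => /(_ tt I).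
  by move=> /card_le0P; rewrite -subset0 => /(_ 0%N I).
pose S (f : X -> X) := [set x | exists y, y <> x /\ f x = f y].
have [ig|nig] := pselect (card_injective L g); last first.
  right => -[_]; apply.
  apply: card_le_trans (card_Nlt nig) (subset_card_le _).
  by move=> x [y [yx gxy]]; exists y; split => //=; rewrite gxy.
have sg : card_surjective L g by case: Mg.
have [sf|nsf] := pselect (card_surjective L f).
  left; apply: (@card_le_lt_trans _ _ _ _ (~` range f `|` f @` (~` range g))).
    apply: subset_card_le => y ny.
    have [[x _ xy]|] := pselect (range f y); last by left.
    by right; exists x => // -[z _ zx]; apply: ny; exists z => //=; rewrite zx.
  apply: one_or_infinite_ltU => //.
  by apply: card_le_lt_trans sg; exact: card_image_le.
have Sf : L #<= S f by case: Mf => // nif; apply: card_Nlt.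
right => ifg; have [_] : card_lt (S f) L; last by apply.
pose R := ~` range g.
(* A point of [Q] has all its partners in [R], and no other point of [Q] can
   share one of them; so [Q] is no larger than [R]. *)
pose Q := [set x | [/\ S f x, ~ R x & forall y, y <> x -> f x = f y -> R y]].
have QR : Q #<= R.
  have /choice[p pP] : forall x, exists y, S f x -> y <> x /\ f x = f y.
    by move=> x; have [[y ?]|?] := pselect (S f x); [exists y|exists x].
  apply: (@inj_on_card_le _ _ _ _ p) => [x [Sx _ xR]|x y].
    by have [px fpx] := pP _ Sx; exact: xR.
  move=> [Sx Rx xR] [Sy Ry yR] pxy; apply: contrapT => xy.
  apply: Ry; apply: xR; first by move/esym.
  by rewrite (pP _ Sx).2 (pP _ Sy).2 pxy.
have QL : card_lt Q L by exact: card_le_lt_trans QR sg.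
have gL : card_lt (g @` S (f \o g)) L.
  by apply: card_le_lt_trans ifg; exact: card_image_le.
apply: (@card_le_lt_trans _ _ _ _ ((R `|` Q) `|` g @` S (f \o g))); last first.
  by do 2 apply: one_or_infinite_ltU => //.
apply: subset_card_le => x Sx.
have [Rx|nRx] := pselect (R x); first by left; left.
have [Qx|nQx] := pselect (Q x); first by left; right.
have [y [yx fxy] nRy] : exists2 y, y <> x /\ f x = f y & ~ R y.
  apply: contrapT => ny; apply: nQx; split => // y yx fxy.
  by apply: contrapT => Ry; apply: ny; exists y.
have [u _ ux] := contrapT nRx; have [v _ vy] := contrapT nRy.
right; exists u => //; exists v; split; last by rewrite /= ux vy.
by move=> vu; apply: yx; rewrite -ux -vy vu.
Qed.

End Monoids.

(** * Separating the listed monoids *)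

Section Separation.
Variable X : pointedType.
Hypothesis Xinf : infinite_set [set: X].
Local Notation K := [set: X].

Lemma one_or_infinite_nonempty (L : set X) : one_or_infinite L -> L !=set0.
Proof.
move=> [|NL]; last exact: card_le_nonempty (I : setT 0%N) NL.
by move=> /card_eqPle[_]; exact: card_le_nonempty (I : setT tt).
Qed.

Lemma monG_of_corange (L : set X) f : L #<= ~` range f -> monG L f.
Proof.
move=> Lf A _; apply: card_le_trans Lf (subset_card_le _).
by apply: subsetC => _ [x _ <-]; exists x.
Qed.

Lemma monG_permutation (L : set X) f : bijective f -> monG L f.
Proof.
move=> fbij A /card_eqPle[_ LA].
apply: card_le_trans LA _; apply: (@inj_on_card_le _ _ _ _ f).
  by move=> x Ax [y Ay /(bij_inj fbij) yx]; apply: Ay; rewrite yx.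
by move=> x y _ _ /(bij_inj fbij).
Qed.

Lemma not_monG (L A : set X) f : L !=set0 -> L #<= A ->
  card_lt (~` (f @` (~` A))) L -> ~ monG L f.
Proof.
move=> [l Ll] LA fA Gf; have [B BA BL] := subset_of_card LA.
have [_] := fA; apply; apply: card_le_trans (Gf _ BL) (subset_card_le _).
apply: subsetC => _ [x Ax <-]; exists x => // /BA; exact: Ax.
Qed.

Lemma empty_lt (L : set X) : L !=set0 -> card_lt (@set0 X) L.
Proof.
move=> [l Ll]; apply: card_ltNge => /card_le0P L0.
by rewrite L0 in Ll.
Qed.

Lemma monM_surjective (L : set X) f : L !=set0 -> range f = setT -> monM L f.
Proof. by move=> L0 fT; left; rewrite /card_surjective fT setCT; exact: empty_lt. Qed.

Lemma monM_permutation (L : set X) f : L !=set0 -> bijective f -> monM L f.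
Proof.
move=> L0 fbij; apply: monM_surjective => //; rewrite -subTset => y _.
by have [x <-] := bijective_surj y fbij; exists x.
Qed.

Lemma not_monM (L : set X) f : L !=set0 -> injective f ->
  L #<= ~` range f -> ~ monM L f.
Proof.
move=> L0 finj Lf [[_ /(_ Lf)//]|]; apply.
rewrite /card_injective (_ : [set x | _] = set0); first exact: empty_lt.
by apply/seteqP; split=> // x [y [yx /finj xy]]; apply: yx.
Qed.

Lemma monA_two_to_one f :
  (forall y, f @^-1` [set y] #<= [set: bool]) -> monA X f.
Proof.
move=> f2; apply: (@small_subset _ _ set0); last exact: small_finite.
by move=> y /=; apply; apply: small_finite => //; exact: card_le_finite (f2 y) _.
Qed.

Lemma monA'_two_to_one f :
  (forall y, f @^-1` [set y] #<= [set: bool]) -> monA' X f.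
Proof.
move=> f2; have [a [b [_ _ ab]]] := infinite_two Xinf.
exists [set a; b]; split; first exact: small_finite.
apply: (@small_subset _ _ set0); last exact: small_finite.
move=> y /=; apply; apply: card_le_trans (f2 y) _.
apply: (@inj_on_card_le _ _ _ _ (fun c : bool => if c then a else b)).
  by move=> []; [left|right].
by move=> [] [] _ _ // /esym.
Qed.

Lemma injective_two_to_one (f : X -> X) y : injective f ->
  f @^-1` [set y] #<= [set: bool].
Proof.
move=> finj; apply: (@inj_on_card_le _ _ _ _ (fun=> true)) => // x x' /= fx fx' _.
by apply: finj; rewrite fx.
Qed.

Lemma not_monA f : K #<= [set y | K #<= f @^-1` [set y]] -> ~ monA X f.
Proof.
move=> Kf Af; have [_] := Af; apply; apply: card_le_trans Kf (subset_card_le _).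
by move=> y Ky [_]; apply.
Qed.

Lemma not_monA' f : K #<= [set y | K #<= f @^-1` [set y]] -> ~ monA' X f.
Proof.
move=> Kf [L [[_ nKL] [_]]]; apply; apply: card_le_trans Kf (subset_card_le _).
by move=> y Ky /(card_le_trans Ky).
Qed.

(** This function lies in all listed monoids but the [monG L]. *)
Lemma two_to_one_surjection : exists (f : X -> X) (A : set X),
  [/\ forall y, f @^-1` [set y] #<= [set: bool], K #<= A & f @` (~` A) = setT].
Proof.
have [C CK nCK] := exists_copy Xinf K.
have [u [_ uinj usurj]] := card_eqE CK; have [v [_ vinj vsurj]] := card_eqE nCK.
exists (fun x => if pselect (C x) then u x else v x), C; split.
- move=> y; apply: (@inj_on_card_le _ _ _ _ (fun x => `[< C x >])) => // x x' /=.
  case: pselect => Cx /=; case: pselect => Cx' /= <- e;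
    move=> /(@asbool_eq_equiv (C x) (C x'))[CC CC'].
  + exact: uinj (esym e).
  + by case: Cx'; exact: CC.
  + by case: Cx; exact: CC'.
  + exact: vinj (esym e).
- by have /card_eqPle[] := CK.
- rewrite -subTset => y _; have [x Cx <-] := vsurj y I.
  by exists x => //; case: pselect.
Qed.

(** Outside [monA] and [monA'] but, as a surjection, in every [monM L]; followed
    by an injection missing [K] points it moves to every [monG L]. *)
Lemma large_fibred_surjection : exists f : X -> X,
  forall y, K #<= f @^-1` [set y].
Proof.
have [q [q' qK q'K]] := pairing Xinf; exists (fun x => (q' x).1) => y.
apply: (@inj_on_card_le _ _ _ _ (fun x => q (y, x))) => [x _|x x' _ _].
  by rewrite /= qK.
by move=> /(can_inj qK)[].
Qed.

Lemma image_covering (A C : set X) : A #= K -> C #= K ->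
  exists2 b : X -> X, b @` A = C & forall x y, A x -> A y -> b x = b y -> x = y.
Proof.
move=> AK CK; have [|b [bC binj bsurj]] := @card_eqE _ _ A C.
  by rewrite (card_eql AK) card_eq_sym.
exists b => //; apply/seteqP; split => [_ [x /bC ? <-]//|y /bsurj[x ? <-]].
by exists x.
Qed.

(** The witness has range the complement of a set of size [|L|], and still has
    this range off a set of size [|L'|]. *)
Lemma monG_not_increasing (L L' : set X) : L !=set0 -> card_lt L L' ->
  ~ (monG L `<=` monG L').
Proof.
move=> L0 LL'; have [C CL nCK] := exists_copy Xinf L.
have [A AL' nAK] := exists_copy Xinf L'.
have [b bC _] := image_covering nAK nCK.
have [c nCc] : (~` C) !=set0.
  by have /card_eqPle[_] := nCK; exact: card_le_nonempty (I : setT point).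
pose f x := if pselect (A x) then c else b x.
have fA : f @` (~` A) = ~` C.
  rewrite -bC; apply/seteqP; split=> [_|_] [x nAx <-]; exists x => //; rewrite /f;
  by case: pselect.
move=> GG; have Gf : monG L' f.
  apply: GG; apply: monG_of_corange; have /card_eqPle[_ /card_le_trans] := CL.
  apply; apply: subset_card_le => y Cy [x _ xy]; rewrite /f in xy.
  case: pselect xy => /= Ax; first by move=> cy; apply: nCc; rewrite cy.
  move=> bxy; have : (b @` (~` A)) y by exists x.
  by rewrite bC; apply.
have [_] := LL'; apply; have := Gf _ AL'; rewrite fA setCK => /card_le_trans; apply.
by have /card_eqPle[] := CL.
Qed.

(** The witness collapses a set [A] of size [|L'|] to a point and maps the
    complement of [A] bijectively onto [X]. Off a set [B] of size [|L|], it misses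
    the images of [B `\` A] with at most one exception. *)
Lemma monG_not_decreasing (L L' : set X) : infinite_set L -> L' !=set0 ->
  card_lt L' L -> ~ (monG L `<=` monG L').
Proof.
move=> iL L'0 LL'; have [A AL' nAK] := exists_copy Xinf L'.
have [b bT binj] := image_covering nAK (card_eqxx K).
pose f x := if pselect (A x) then point else b x.
have fb x : ~ A x -> f x = b x by rewrite /f; case: pselect.
move=> /(_ f) GG; have [] : ~ monG L' f; last apply: GG.
  apply: (@not_monG _ A) => //; first by have /card_eqPle[] := AL'.
  rewrite (_ : f @` _ = setT) ?setCT; first exact: empty_lt.
  rewrite -subTset => y _; have [x nAx <-] : (b @` (~` A)) y by rewrite bT.
  by exists x => //; exact: fb.
move=> B BL.
have AL : card_lt A L by rewrite (card_lt_eql _ AL').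
have LB : L #<= B by have /card_eqPle[] := BL.
have LBA : L #<= b @` (B `\` A).
  apply: card_le_trans (card_leD iL LB AL) _.
  apply: (@inj_on_card_le _ _ _ _ b) => [x ?|x y [_ ?] [_ ?]]; first by exists x.
  exact: binj.
have := card_leD iL LBA (finite_card_lt (finite_set1 point) iL).
move=> /card_le_trans; apply; apply: subset_card_le.
move=> _ [[x [Bx nAx] <-] bp] [y nBy]; rewrite /f; case: pselect => /= Ay.
  by move=> py; apply: bp.
by move=> /(binj _ _ Ay nAx) yx; apply: nBy; rewrite yx.
Qed.

Lemma infinite_of_gt (L L' : set X) : one_or_infinite L -> L' !=set0 ->
  card_lt L' L -> infinite_set L.
Proof.
move=> [L1|/infiniteP//] [x L'x] [_ nLL']; case: nLL'.
rewrite (card_le_eql L1); apply: (@inj_on_card_le _ _ _ _ (fun=> x)) => //.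
by move=> [] [].
Qed.

Lemma card_eq_of_Nlt T U (A : set T) (B : set U) :
  ~ card_lt A B -> ~ card_lt B A -> A #= B.
Proof. by move=> /card_Nlt BA /card_Nlt AB; apply/card_eqPle. Qed.

Lemma monG_sub_card_eq (L L' : set X) : one_or_infinite L -> one_or_infinite L' ->
  monG L `<=` monG L' -> L #= L'.
Proof.
move=> oL oL' GG.
have L0 := one_or_infinite_nonempty oL; have L'0 := one_or_infinite_nonempty oL'.
apply: card_eq_of_Nlt => [LL'|L'L]; first exact: monG_not_increasing LL' GG.
exact: monG_not_decreasing (infinite_of_gt oL L'0 L'L) L'0 L'L GG.
Qed.

(** The witness is an injection missing [K] points, modified by collapsing a
    set [P] to a point. The set of points where it fails to be injective is [P],
    whose size lies between [|L|] and [|L'|], the latter excluded; it has two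
    elements even when [|L|] is 1. *)
Lemma monM_not_increasing (L L' : set X) : one_or_infinite L ->
  infinite_set L' -> card_lt L L' -> ~ (monM L `<=` monM L').
Proof.
move=> oL iL' LL'.
(* Two elements replace [L] if it is a singleton: a function cannot fail to
   be injective at a single point. *)
have [P [LP PL' [p0 [p1 [Pp0 Pp1 p01]]]]] : exists P : set X, [/\ L #<= P,
    card_lt P L' & exists p0 p1, [/\ P p0, P p1 & p0 <> p1]].
  have [L1|/infiniteP iL] := oL; last first.
    by exists L; split => //; exact: infinite_two.
  have [a [b [_ _ ab]]] := infinite_two Xinf; exists [set a; b]; split.
  - rewrite (card_le_eql L1); apply: (@inj_on_card_le _ _ _ _ (fun=> a)).
      by left.
    by move=> [] [].
  - exact: finite_card_lt.
  - by exists a, b; split => //; [left|right].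
have [j jinj Kj] := large_corange_injection Xinf.
pose f x := if pselect (P x) then j p0 else j x.
have fP x : P x -> f x = j p0 by rewrite /f; case: pselect.
have fNP x : ~ P x -> f x = j x by rewrite /f; case: pselect.
pose S := [set x | exists y, y <> x /\ f x = f y].
have SP : S `<=` P.
  move=> x [y [yx]]; have [//|nPx] := pselect (P x); rewrite (fNP x)//.
  have [Py|nPy] := pselect (P y); first by rewrite fP// => /jinj ->.
  by rewrite fNP// => /jinj xy; case: yx.
have PS : P `<=` S.
  move=> x Px; have [xp0|xp0] := pselect (p0 = x).
    by exists p1; split; [rewrite -xp0; exact: nesym|rewrite !fP].
  by exists p0; rewrite !fP.
move=> /(_ f) [].
- right => -[_]; apply; apply: card_le_trans LP _; exact: subset_card_le.
- move=> [_]; apply; apply: card_le_trans (card_leT _) _.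
  apply: card_le_trans Kj (subset_card_le _); apply: subsetC => _ [x _ <-].
  by rewrite /f; case: pselect => Px /=; [exists p0|exists x].
- apply; apply: card_le_lt_trans PL'; exact: subset_card_le.
Qed.

(** The witness is an injection missing exactly [|L'|] points. *)
Lemma monM_not_decreasing (L L' : set X) : L' !=set0 ->
  card_lt L' L -> ~ (monM L `<=` monM L').
Proof.
move=> L'0 L'L; have [C CL' nCK] := exists_copy Xinf L'.
have [b bC binj] := image_covering (card_eqxx K) nCK.
move=> /(_ b); rewrite /monM /= => MM.
have [] : ~ monM L' b; last apply: MM.
  apply: not_monM => //; first by move=> x y; exact: binj.
  by rewrite bC setCK; have /card_eqPle[] := CL'.
by left; rewrite /card_surjective bC setCK (card_lt_eql _ CL').
Qed.

Lemma monM_sub_card_eq (L L' : set X) : one_or_infinite L -> one_or_infinite L' ->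
  monM L `<=` monM L' -> L #= L'.
Proof.
move=> oL oL' MM.
have L0 := one_or_infinite_nonempty oL; have L'0 := one_or_infinite_nonempty oL'.
apply: card_eq_of_Nlt => [LL'|L'L].
  exact: monM_not_increasing (infinite_of_gt oL' L0 LL') LL' MM.
exact: monM_not_decreasing L'L MM.
Qed.

Lemma monG_card_eq (L L' : set X) : L #= L' -> monG L = monG L'.
Proof.
move=> LL'; apply/seteqP; split => f Gf A AL.
  by rewrite -(card_le_eql LL'); apply: Gf; rewrite (card_eqr LL').
by rewrite (card_le_eql LL'); apply: Gf; rewrite -(card_eqr LL').
Qed.

Lemma monM_card_eq (L L' : set X) : L #= L' -> monM L = monM L'.
Proof.
move=> LL'; apply/seteqP; split => f; rewrite /monM /= /card_surjective
  /card_injective !(card_lt_eqr _ LL')//.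
Qed.

End Separation.

(** * The classification *)

Section Classification.
Variable X : pointedType.
Hypothesis Xinf : infinite_set [set: X].
Local Notation K := [set: X].

(** With [X] covered by a small family [F] of small sets, indexed injectively by
    a small subset [D] of [X], distinct representatives give an injection [c] of
    [X * D] such that the fibre of [h] over [c (z, e B)] is at least as large as
    [B]. Some [s] in [N] has all fibres at least as large as [D], and a
    permutation moves the column [c (z, D)] into the fibre of [s] over [z]. The
    fibre over [z] of the composite is then at least as large as the union of [F],
    which is [X]. *)
Lemma singular_large_fibres (N : set (X -> X)) f (A : set X) h :
  submonoid N -> all_permutations X `<=` N ->
  N f -> K #<= A -> f @` (~` A) = setT ->
  singular_card X -> N h -> ~ monA' X h ->
  exists2 k, N k & K #<= [set y | K #<= k @^-1` [set y]].
Proof.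
move=> Nmon Nperm Nf KA fA sing Nh nAh.
have Kh (L : set X) : small L -> K #<= [set y | ~ (h @^-1` [set y] #<= L)].
  by move=> sL; apply: card_Nlt => sm; apply: nAh; exists L.
have [F [FK [Fsmall FT]]] : exists F : set (set X),
    card_lt F K /\ (forall B, F B -> small B) /\ \bigcup_(B in F) B = setT.
  apply: contrapT => nF; apply: sing => F FK Fs FT; apply: nF.
  by exists F.
have [e [_ einj]] := card_leE FK.1.
pose D := e @` F.
have sD : small D by apply: card_le_lt_trans FK; exact: card_image_le.
have [q [q' qK q'K]] := pairing Xinf.
(* Away from [D] the second coordinate indexes no member of [F], and [Y] puts
   no constraint there. *)
pose Y x := [set y | forall B, F B -> e B = (q' x).2 -> ~ (h @^-1` [set y] #<= B)].
have KY x : K #<= Y x.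
  have [[B FB eB]|nD] := pselect (D (q' x).2).
    apply: card_le_trans (Kh _ (Fsmall _ FB)) (subset_card_le _) => y hy C FC.
    by rewrite -eB => /(einj _ _ FC FB) ->.
  by apply: subset_card_le => y _ B FB eB; case: nD; exists B.
have [c cinj cY] := distinct_representatives KY.
have [s Ns sP] := fibres_everywhere Xinf Nmon Nperm Nf KA fA Nh (Kh _ sD).
have /choice[v vP] : forall z, exists v : X -> X, (forall d, D d -> s (v d) = z) /\
    (forall d d', D d -> D d' -> v d = v d' -> d = d').
  move=> z; have [y ny hy] := sP z.
  have /card_leE[v [vs vinj]] : D #<= s @^-1` [set z].
    apply: card_le_trans (card_Nlt _) (subset_card_le hy).
    by move=> [].
  by exists v.
have [d0 Dd0] : D !=set0.
  apply/set0P/eqP => D0; have : (\bigcup_(B in F) B) point by rewrite FT.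
  move=> [B FB _]; have : D (e B) by exists B.
  by rewrite D0.
have [d1 nDd1] : (~` D) !=set0.
  by have := large_complement Xinf sD; exact: card_le_nonempty (I : setT point).
have [j jinj Kj] := large_corange_injection Xinf.
(* Only the columns over the range of [j] are moved: the other fibres of [s]
   remain free, so that the permutation can be completed. *)
pose G : set (X * X) := range j `*` D.
pose w (t : X * X) := v t.1 t.2.
have [|||p pbij pcw] := @permutation_extension _ X G (c \o q) w.
- by move=> t t' _ _ /cinj/(can_inj qK).
- move=> [z d] [z' d'] /set_mem[/= _ Dd] /set_mem[/= _ Dd']; rewrite /w /= => vv.
  have zz : z = z' by rewrite -((vP z).1 _ Dd) vv (vP z').1.
  by rewrite -zz in vv *; rewrite ((vP z).2 _ _ Dd Dd' vv).
- have Kc : K #<= ~` ((c \o q) @` G).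
    apply: (@inj_on_card_le _ _ _ _ (fun z => c (q (z, d1)))).
      by move=> z _ [[z' d] [_ /= Dd] /cinj/(can_inj qK)[_ dd]]; rewrite dd in Dd.
    by move=> z z' _ _ /cinj/(can_inj qK)[].
  rewrite (card_eql (large_eq Kc)) card_eq_sym; apply: large_eq.
  apply: card_le_trans Kj _; apply: (@inj_on_card_le _ _ _ _ (fun z => v z d0)).
    move=> z nz [[z' d] [/= jz' Dd]]; rewrite /w /= => vv; apply: nz.
    by rewrite -((vP z).1 _ Dd0) -vv (vP z').1.
  by move=> z z' _ _ vv; rewrite -((vP z).1 _ Dd0) vv (vP z').1.
exists (s \o (p \o h)).
  by do 2 apply: Nmon.2 => //; exact: Nperm.
suff big z : range j z -> K #<= (s \o (p \o h)) @^-1` [set z].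
  apply: (@inj_on_card_le _ _ _ _ j) => [x _|x y _ _]; last exact: jinj.
  by apply: big; exists x.
move=> jz.
have /choice[b bP] : forall x, exists B, F B /\ B x.
  by move=> x; have [B FB Bx] : (\bigcup_(B in F) B) x by [rewrite FT]; exists B.
have hc (B : set X) : F B -> B #<= h @^-1` [set c (q (z, e B))].
  move=> FB; apply: card_Nlt => -[hB _].
  by have := cY (q (z, e B)) B FB; rewrite qK; apply.
have /choice[u uP] : forall B, exists u : X -> X, F B ->
    (forall x, B x -> h (u x) = c (q (z, e B))) /\
    (forall x y, B x -> B y -> u x = u y -> x = y).
  move=> B; have [FB|nFB] := pselect (F B); last by exists id.
  by have [u [uh uinj]] := card_leE (hc _ FB); exists u.
apply: (@inj_on_card_le _ _ _ _ (fun x => u (b x) x)).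
  move=> x _ /=; have [Fb bx] := bP x; rewrite (uP _ Fb).1//.
  have De : D (e (b x)) by exists (b x).
  by have /= -> := pcw (z, e (b x)) (conj jz De); rewrite /w /= (vP z).1.
move=> x y _ _ uxy; have [Fx bx] := bP x; have [Fy bby] := bP y.
have : c (q (z, e (b x))) = c (q (z, e (b y))).
  by rewrite -((uP _ Fx).1 x bx) -((uP _ Fy).1 y bby) uxy.
move=> /cinj/(can_inj qK)[] /(einj _ _ Fx Fy) bxy.
by move: uxy; rewrite -bxy; apply: (uP _ Fx).2 => //; rewrite bxy.
Qed.

Definition candidate (B : set (X -> X)) : set (set (X -> X)) :=
  [set M | M = B \/
    exists L : set X, one_or_infinite L /\ (M = monG L \/ M = monM L)].

(** A family of proper submonoids such that none includes another and such that
    each proper submonoid containing the permutations is included in one of them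
    consists of the maximal ones. The monoid [B], which depends on the
    regularity of the cardinal, enters only through four properties: it is a
    submonoid, it contains the functions whose fibres have at most two elements,
    it contains no function with [K] fibres of size [K], and functions outside it
    help to generate one. *)
Lemma maximal_iff_candidate (B : set (X -> X)) :
  submonoid B ->
  (forall f, (forall y, f @^-1` [set y] #<= [set: bool]) -> B f) ->
  (forall f, K #<= [set y | K #<= f @^-1` [set y]] -> ~ B f) ->
  (forall (N : set (X -> X)) f (A : set X) h,
     submonoid N -> all_permutations X `<=` N ->
     N f -> K #<= A -> f @` (~` A) = setT -> N h -> ~ B h ->
     exists2 k, N k & K #<= [set y | K #<= k @^-1` [set y]]) ->
  forall M : set (X -> X),
    (maximal_submonoid M /\ all_permutations X `<=` M) <-> candidate B M.
Proof.
move=> Bmon B2 nB Bgen.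
have [j jinj Kj] := large_corange_injection Xinf.
have Bj : B j by apply: B2 => y; exact: injective_two_to_one.
have Gj L : monG L j by apply: monG_of_corange; exact: card_le_trans (card_leT _) Kj.
have nMj L : one_or_infinite L -> ~ monM L j.
  move=> /one_or_infinite_nonempty L0; apply: not_monM => //.
  exact: card_le_trans (card_leT _) Kj.
have [t [A [t2 KA tA]]] := two_to_one_surjection Xinf.
have Bt : B t by exact: B2.
have Mt L : one_or_infinite L -> monM L t.
  move=> /one_or_infinite_nonempty L0; apply: monM_surjective => //.
  rewrite -subTset => y _; have [x _ <-] : (t @` (~` A)) y by rewrite tA.
  by exists x.
have nGt L : one_or_infinite L -> ~ monG L t.
  move=> /one_or_infinite_nonempty L0; apply: (@not_monG _ _ A) => //.
    exact: card_le_trans (card_leT _) KA.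
  by rewrite tA setCT; exact: empty_lt.
have [r Kr] := large_fibred_surjection Xinf.
have nBr : ~ B r by apply: nB; apply: subset_card_le => y _; exact: Kr.
have Mr L : one_or_infinite L -> monM L r.
  move=> /one_or_infinite_nonempty L0; apply: monM_surjective => //.
  rewrite -subTset => y _; have [x /= rx] := card_le_nonempty (I : setT point) (Kr y).
  by exists x.
have Gjr L : monG L (j \o r).
  apply: monG_of_corange; apply: card_le_trans (card_leT _) _.
  apply: card_le_trans Kj (subset_card_le _); apply: subsetC => _ [x _ <-].
  by exists (r x).
have nBjr : ~ B (j \o r).
  apply: nB; apply: (@inj_on_card_le _ _ _ _ j) => [y _|x y _ _]; last exact: jinj.
  by apply: card_le_trans (Kr y) (subset_card_le _) => x /= ->.
have cand_mon M : candidate B M ->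
    [/\ submonoid M, M <> setT & all_permutations X `<=` M].
  move=> [->|[L [oL [->|->]]]]; split => //.
  - by move=> BT; apply: nBr; rewrite BT.
  - by move=> f fbij; apply: B2 => y; apply: injective_two_to_one; exact: bij_inj.
  - exact: submonoid_monG.
  - by move=> GT; apply: (nGt L) => //; rewrite GT.
  - by move=> f; exact: monG_permutation.
  - exact: submonoid_monM.
  - by move=> MT; apply: (nMj L) => //; rewrite MT.
  - by move=> f; apply: monM_permutation; exact: one_or_infinite_nonempty.
have antichain M M' : candidate B M -> candidate B M' -> M `<=` M' -> M = M'.
  move=> [->|[L [oL [->|->]]]] [->|[L' [oL' [->|->]]]] // sub.
  - by case: (nGt L' oL'); exact: sub.
  - by case: (nMj L' oL'); exact: sub.
  - by case: nBjr; exact: sub.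
  - by apply: monG_card_eq; exact: monG_sub_card_eq sub.
  - by case: (nMj L' oL'); exact: sub.
  - by case: nBr; apply: sub; exact: Mr.
  - by case: (nGt L' oL'); apply: sub; exact: Mt.
  - by apply: monM_card_eq; exact: monM_sub_card_eq sub.
have cover N : submonoid N -> all_permutations X `<=` N -> N <> setT ->
    exists2 M, candidate B M & N `<=` M.
  move=> Nmon Nperm NT; apply: contrapT => ncover; apply: NT.
  have avoid M : candidate B M -> ~ (N `<=` M).
    by move=> cM NM; apply: ncover; exists M.
  have [g [Ng ginj Kg]] : exists g, [/\ N g, injective g & K #<= ~` range g].
    apply: injection_of_corange_ge => // L oL; apply: avoid; right.
    by exists L; split => //; right.
  have [f [D [Nf KD fD]]] : exists (f : X -> X) (D : set X),
      [/\ N f, K #<= D & f @` (~` D) = setT].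
    apply: surjection_off_ge => // L oL; apply: avoid; right.
    by exists L; split => //; left.
  have /existsNP[h /not_implyP[Nh nBh]] := avoid B (or_introl erefl).
  have [k Nk Kk] := Bgen _ _ _ _ Nmon Nperm Nf KD fD Nh nBh.
  have [s Ns sP] := fibres_everywhere Xinf Nmon Nperm Nf KD fD Nk Kk.
  apply: (all_from_large_fibres Xinf Nmon (s := s)) => // [i iinj Ki|z].
    exact: (large_corange_injections_in Nmon Nperm Ng).
  by have [y Ky ys] := sP z; exact: card_le_trans Ky (subset_card_le ys).
move=> M; split => [[[Mmon MT Mmax] Mperm]|cM].
  have [M' cM' MM'] := cover M Mmon Mperm MT.
  have [mon' T' _] := cand_mon _ cM'.
  by rewrite -(Mmax M').
have [Mmon MT Mperm] := cand_mon _ cM; split => //; split => // N Nmon NT MN.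
have [M' cM' NM'] := cover N Nmon (subset_trans Mperm MN) NT.
have MM' := antichain _ _ cM cM' (subset_trans MN NM').
by apply/seteqP; split => //; rewrite MM'.
Qed.

End Classification.

Theorem theorem78 (X : Type) (hX : infinite_set [set: X]) :
  (regular_card X ->
    forall M : set (X -> X),
      (maximal_submonoid M /\ all_permutations X `<=` M) <->
      (M = monA X \/
       exists L : set X, one_or_infinite L /\ (M = monG L \/ M = monM L))) /\
  (singular_card X ->
    forall M : set (X -> X),
      (maximal_submonoid M /\ all_permutations X `<=` M) <->
      (M = monA' X \/
       exists L : set X, one_or_infinite L /\ (M = monG L \/ M = monM L))).
Proof.
elim/Ppointed: X => X in hX *.
  by case: hX; exists 0%N; rewrite [setT]empty_eq0 II0; exact: card_eq00.
split=> [reg|sing]; apply: maximal_iff_candidate => //.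
- exact: submonoid_monA.
- exact: monA_two_to_one.
- exact: not_monA.
- move=> N f A h _ _ _ _ _ Nh nAh; exists h => //.
  by apply: card_le_trans (card_Nlt nAh) (subset_card_le _) => y; exact: card_Nlt.
- exact: submonoid_monA'.
- exact: monA'_two_to_one.
- exact: not_monA'.
- move=> N f A h Nmon Nperm Nf KA fA; exact: singular_large_fibres KA fA sing.
Qed.
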